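(* Let $k_0$ be a nonzero integer satisfying at least one of the following congruences: $k_0 \equiv 1 \pmod 2$; $k_0 \equiv 1,2 \pmod 3$; $k_0 \equiv 2,3 \pmod 5$; $k_0 \equiv 1,2,5,6 \pmod 7$; $k_0 \equiv 1,2,5,6,9,10 \pmod{11}$; $k_0 \equiv 3,6,7,10 \pmod{13}$; $k_0 \equiv 1,3,14,16 \pmod{17}$; $k_0 \equiv 6,7,9,10,12,13 \pmod{19}$; $k_0 \equiv 1,6,8,9,14,15,17,22 \pmod{23}$; $k_0 \equiv 2,11,12,14,15,17,18,27 \pmod{29}$; $k_0 \equiv 6,10,11,14,17,20,21,25 \pmod{31}$; $k_0 \equiv 6,8,10,11,14,17,18,19,20,23,26,27,29,31 \pmod{37}$; $k_0 \equiv 2,11,13,14,15,26,27,28,30,39 \pmod{41}$; $k_0 \equiv 4,5,12,14,17,21,22,26,29,31,38,39 \pmod{43}$; $k_0 \equiv 4,7,11,12,15,19,21,26,28,32,35,36,40,43 \pmod{47}$; $k_0 \equiv 2,19,22,25,26,27,28,31,34,51 \pmod{53}$; $k_0 \equiv 1,3,7,8,51,25,29,30,34,52,56,58 \pmod{59}$; $k_0 \equiv 1,2,3,12,17,24,29,30,31,32,37,44,49,58,59,60 \pmod{61}$; $k_0 \equiv 5,6,9,15,18,22,27,30,32,33,34,35,37,40,45,49,52,58,61,62 \pmod{67}$; $k_0 \equiv 6,7,11,12,16,20,27,28,30,33,38,41,43,44,51,55,59,60,64,65 \pmod{71}$; $k_0 \equiv 6,7,12,13,14,20,24,29,32,33,40,41,44,49,53,59,60,61,66,67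 \pmod{73}$; $k_0 \equiv 20,68 \pmod{79}$; $k_0 \equiv 12,16,21,62,71 \pmod{83}$; $k_0 \equiv 9,50 \pmod{103}$; $k_0 \equiv 106 \pmod{107}$; $k_0 \equiv 92 \pmod{109}$; $k_0 \equiv 26,105 \pmod{131}$; $k_0 \equiv 89 \pmod{149}$; $k_0 \equiv 24 \pmod{157}$; $k_0 \equiv 19 \pmod{173}$; $k_0 \equiv 52,145 \pmod{197}$. Then $\delta_n(k_0)$ is not a perfect square for every $n \geq 1$. Moreover, $\delta_n(k_0)$ is not a perfect square for every $n \geq 1$ and every integer $k_0$ with $1 \leq |k_0| \leq 10^6$.
   Context: The polynomials $\delta_n, \varepsilon_n \in \mathbb{Z}[k]$, $n \geq 1$, are defined by $(\delta_1(k),\varepsilon_1(k)) = (2k^2, k)$ and, for $n \geq 2$, $\delta_n(k) = \delta_{n-1}(k)^2 + \varepsilon_{n-1}(k)^2$, $\varepsilon_n(k) = \delta_{n-1}(k)\varepsilon_{n-1}(k)/k$. *)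

(* Defs.v *)
From HB Require Import structures.
From mathcomp Require Import all_boot all_order all_algebra.
Set Implicit Arguments.
Unset Strict Implicit.
Unset Printing Implicit Defensive.
Import GRing.Theory.
Local Open Scope ring_scope.

(* The pair (delta_n, epsilon_n), n >= 1; the value at n = 0 is a dummy.
   Division by 'X is the pseudo-division of polydiv; the divisor being monic, it
   is the Euclidean one, and [epsilon_mulX] shows that it is exact. *)
Fixpoint delta_epsilon (n : nat) : {poly int} * {poly int} :=
  if n is (m.+1 as p).+1 then
    let: (d, e) := delta_epsilon p in (d ^+ 2 + e ^+ 2, (d * e) %/ 'X)
  else (2 *: 'X^2, 'X).

Definition delta (n : nat) : {poly int} := (delta_epsilon n).1.
Definition epsilon (n : nat) : {poly int} := (delta_epsilon n).2.

Lemma delta1 : delta 1 = 2 *: 'X^2. Proof. by []. Qed.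

Lemma epsilon1 : epsilon 1 = 'X. Proof. by []. Qed.

Lemma delta_epsilonS n : delta_epsilon n.+2 =
  let: (d, e) := delta_epsilon n.+1 in (d ^+ 2 + e ^+ 2, (d * e) %/ 'X).
Proof. by []. Qed.

Lemma deltaS n : delta n.+2 = delta n.+1 ^+ 2 + epsilon n.+1 ^+ 2.
Proof. by rewrite /delta delta_epsilonS /epsilon; case: delta_epsilon. Qed.

Lemma epsilonS n : epsilon n.+2 = (delta n.+1 * epsilon n.+1) %/ 'X.
Proof. by rewrite /epsilon delta_epsilonS /delta; case: delta_epsilon. Qed.

Lemma dvdX_delta_epsilon n : ('X %| delta n.+1) && ('X %| epsilon n.+1).
Proof.
elim: n => [|n /andP[Xd Xe]].
  by rewrite delta1 epsilon1 dvdpp -mul_polyC exprS mulrCA dvdp_mulr.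
rewrite deltaS epsilonS dvdp_add ?exprS ?dvdp_mulr //=.
have /(Pdiv.IdomainMonic.dvdpP (monicX _)) [u ->] := Xd.
by rewrite mulrAC Pdiv.IdomainMonic.mulpK ?monicX // dvdp_mull.
Qed.

Lemma epsilon_mulX n : epsilon n.+2 * 'X = delta n.+1 * epsilon n.+1.
Proof.
have /andP[Xd _] := dvdX_delta_epsilon n.
rewrite epsilonS; have /(Pdiv.IdomainMonic.dvdpP (monicX _)) [u ->] := Xd.
by rewrite mulrAC Pdiv.IdomainMonic.mulpK ?monicX.
Qed.

Definition is_perfect_square (a : int) : Prop := exists m : int, a = m ^+ 2.

(* An entry (p, rs) lists residues modulo p. *)
Definition residue_table : seq (int * seq int) :=
  ([:: (2, [:: 1]);
       (3, [:: 1; 2]);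
       (5, [:: 2; 3]);
       (7, [:: 1; 2; 5; 6]);
       (11, [:: 1; 2; 5; 6; 9; 10]);
       (13, [:: 3; 6; 7; 10]);
       (17, [:: 1; 3; 14; 16]);
       (19, [:: 6; 7; 9; 10; 12; 13]);
       (23, [:: 1; 6; 8; 9; 14; 15; 17; 22]);
       (29, [:: 2; 11; 12; 14; 15; 17; 18; 27]);
       (31, [:: 6; 10; 11; 14; 17; 20; 21; 25]);
       (37, [:: 6; 8; 10; 11; 14; 17; 18; 19; 20; 23; 26; 27; 29; 31]);
       (41, [:: 2; 11; 13; 14; 15; 26; 27; 28; 30; 39]);
       (43, [:: 4; 5; 12; 14; 17; 21; 22; 26; 29; 31; 38; 39]);
       (47, [:: 4; 7; 11; 12; 15; 19; 21; 26; 28; 32; 35; 36; 40; 43]);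
       (53, [:: 2; 19; 22; 25; 26; 27; 28; 31; 34; 51]);
       (59, [:: 1; 3; 7; 8; 51; 25; 29; 30; 34; 52; 56; 58]);
       (61, [:: 1; 2; 3; 12; 17; 24; 29; 30; 31; 32; 37; 44; 49; 58;
         59; 60]);
       (67, [:: 5; 6; 9; 15; 18; 22; 27; 30; 32; 33; 34; 35; 37; 40;
         45; 49; 52; 58; 61; 62]);
       (71, [:: 6; 7; 11; 12; 16; 20; 27; 28; 30; 33; 38; 41; 43; 44;
         51; 55; 59; 60; 64; 65]);
       (73, [:: 6; 7; 12; 13; 14; 20; 24; 29; 32; 33; 40; 41; 44; 49;
         53; 59; 60; 61; 66; 67]);
       (79, [:: 20; 68]);
       (83, [:: 12; 16; 21; 62; 71]);
       (103, [:: 9; 50]);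
       (107, [:: 106]);
       (109, [:: 92]);
       (131, [:: 26; 105]);
       (149, [:: 89]);
       (157, [:: 24]);
       (173, [:: 19]);
       (197, [:: 52; 145])])%Z.

Definition satisfies_congruence (k : int) : Prop :=
  exists2 c, c \in residue_table & exists2 r, r \in c.2 & (k = r %[mod c.1])%Z.

(* Main.v *)
From Stdlib Require Import ZArith Lia.
Require Import Defs.
From mathcomp Require Import all_boot all_order all_algebra.
From mathcomp Require Import zify ssrZ.
Import GRing.Theory.

Local Open Scope Z_scope.

(** Removing square factors turns the recursion into an integer dynamical system. Put K = k^2 and
    F(x, y) = K x^2 + y^2, let [step] send (x, y) to (F^2 + x^2 y^2, F x y), and let (x_j, y_j) be
    the orbit of (2, 1). Up to nonzero square factors, delta_{2j+1}(k) is x_j and delta_{2j+2}(k) is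
    F(x_j, y_j) ([delta_epsilon_orbit]). As K is 0 or 1 mod 3, x_j is always 2 mod 3, hence not a
    square ([orbit_mod3]).

    For F(x_j, y_j) with j < 3, every nonzero k is excluded: the value lies strictly between
    consecutive squares, by Runge's argument when j = 2, where the finitely many small k are treated
    modulo primes ([form_orbit_pt_lt3]). For j >= 3, the class of k modulo m determines the orbit
    modulo m, which is eventually periodic, so a finite computation can show that F never meets a
    square modulo m ([nonsquare_classP]). It succeeds for every listed class, with 8 in place of the
    modulus 2. Up to 10^6 the classes modulo 2 and 3 leave only multiples of 6, and a sieve shows
    that these are covered by the listed classes and some extra ones ([tables_cover]). *)

(** * Reduction to an integer orbit *)

Lemma square_div_square (y s m : Z) :
  y <> 0 -> y * y * s = m * m -> exists r, s = r * r.
Proof.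
move=> y0 ysm.
have [g [gE g_ge0]] : exists g, Z.gcd y m = g /\ 0 <= g.
  by exists (Z.gcd y m); split=> //; exact: Z.gcd_nonneg.
have g0 : g <> 0 by rewrite -gE => /Z.gcd_eq_0_l.
have [[a ya] [b mb]] : (g | y) /\ (g | m).
  by rewrite -gE; split; [exact: Z.gcd_divide_l | exact: Z.gcd_divide_r].
have ab1 : Z.gcd a b = 1.
  apply: (Z.mul_reg_r _ _ _ g0); rewrite Z.mul_1_l -{2}gE ya mb.
  by rewrite Z.gcd_mul_mono_r Z.abs_eq.
have {}ysm : a * a * s = b * b.
  by apply: (Z.mul_reg_r _ _ (g * g)); [nia | rewrite ya mb in ysm; lia].
have a_b : (a | b) by apply: (Z.gauss _ b) => //; exists (a * s); lia.
have : (a | 1) by rewrite -ab1; apply: Z.gcd_greatest => //; exact: Z.divide_refl.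
by move=> /Z.divide_1_r [] a1; exists b; rewrite -ysm a1; lia.
Qed.

Definition form (K : Z) (x : Z * Z) : Z := K * (x.1 * x.1) + x.2 * x.2.

Definition step (K : Z) (x : Z * Z) : Z * Z :=
  let s := form K x in let t := x.1 * x.2 in (s * s + t * t, s * t).

Definition orbit_pt (K : Z) (j : nat) : Z * Z := iter j (step K) (2, 1).

(** One [step] is two turns of the recursion. If D = (y k)^2 X and E = y^2 k Y, then D^2 + E^2 =
    (y^2 k)^2 (K X^2 + Y^2); one turn later the same shape returns with y^4 k in place of y. *)
Lemma delta_epsilon_orbit (k : Z) (D E : nat -> Z) :
    k <> 0 -> D 0%N = 2 * (k * k) -> E 0%N = k ->
    (forall n, D n.+1 = D n * D n + E n * E n) ->
    (forall n, E n.+1 * k = D n * E n) ->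
  forall j, exists2 y, y <> 0 &
    [/\ D j.*2 = (y * k) * (y * k) * (orbit_pt (k * k) j).1,
        E j.*2 = y * y * k * (orbit_pt (k * k) j).2 &
        D j.*2.+1 = (y * y * k) * (y * y * k) *
                    form (k * k) (orbit_pt (k * k) j)].
Proof.
move=> k0 D0 E0 DS ES; elim=> [|j [y y0 [Dj Ej DSj]]].
  exists 1; first by [].
  rewrite DS double0 D0 E0 /form /orbit_pt [iter _ _ _]/=.
  by split; cbn [fst snd]; ring.
have ESj : E j.*2.+1 = (y * y * k) * (y * y * k) *
    ((orbit_pt (k * k) j).1 * (orbit_pt (k * k) j).2).
  by apply: (Z.mul_reg_r _ _ k k0); rewrite ES Dj Ej; ring.
have DSS : D j.+1.*2 = (y * y * (y * y) * k * k) * (y * y * (y * y) * k * k) *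
    (orbit_pt (k * k) j.+1).1.
  by rewrite doubleS DS DSj ESj /orbit_pt /=; ring.
have ESS : E j.+1.*2 = y * y * (y * y) * k * (y * y * (y * y) * k) * k *
    (orbit_pt (k * k) j.+1).2.
  apply: (Z.mul_reg_r _ _ k k0).
  by rewrite doubleS ES DSj ESj /orbit_pt /=; ring.
exists (y * y * (y * y) * k) => //; first by nia.
split=> //.
by rewrite DS DSS ESS /form; ring.
Qed.

(** * Orbits modulo m *)

Definition reduce (m : Z) (x : Z * Z) : Z * Z := (x.1 mod m, x.2 mod m).

Definition stepm (m K : Z) (x : Z * Z) : Z * Z := reduce m (step K x).

Lemma form_reduce (m K : Z) (x : Z * Z) :
  eqm m (form (K mod m) (reduce m x)) (form K x).
Proof. by apply: Zplus_eqm; repeat apply: Zmult_eqm; exact: Zmod_eqm. Qed.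

Lemma stepm_reduce (m K : Z) (x : Z * Z) :
  stepm m (K mod m) (reduce m x) = reduce m (step K x).
Proof.
have fE := form_reduce m K x.
have tE : eqm m (x.1 mod m * (x.2 mod m)) (x.1 * x.2).
  by apply: Zmult_eqm; exact: Zmod_eqm.
rewrite /stepm /step {1}/reduce {2}/reduce; congr (_, _); last exact: Zmult_eqm.
by apply: Zplus_eqm; exact: Zmult_eqm.
Qed.

(** The left side is reduced once more because at j = 0 the point (2, 1) need not be reduced modulo
    m. *)
Lemma orbit_pt_mod (m K : Z) (j : nat) :
  reduce m (iter j (stepm m (K mod m)) (2, 1)) = reduce m (orbit_pt K j).
Proof.
have redK x : reduce m (reduce m x) = reduce m x by rewrite /reduce /= !Zmod_mod.
elim: j => [//|j IH]; rewrite [orbit_pt K _]iterS iterS -[RHS]stepm_reduce -IH.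
by rewrite [in LHS]/stepm redK -stepm_reduce Zmod_mod.
Qed.

Lemma orbit_mod3 (K : Z) (j : nat) : K mod 3 = 0 \/ K mod 3 = 1 ->
  (orbit_pt K j).1 mod 3 = 2.
Proof.
move=> K01; have [<- _] := orbit_pt_mod 3 K j; set y := iter _ _ _.
(* These two states are closed under [stepm 3] for both values of K. *)
have : y \in [:: (2, 1); (2, 2)].
  rewrite /y; elim: j {y} => [//|j]; rewrite iterS !inE.
  by case: K01 => -> /orP[] /eqP ->.
by rewrite !inE => /orP[] /eqP ->.
Qed.

                                                                                 
                                                                       
(** Success means that the orbit came back to a visited state before meeting a square. Running out
    of fuel counts as failure, so the amount of fuel cannot affect soundness. *)
Fixpoint orbit_avoids (m K : Z) (squares : seq Z) (fuel : nat)
    (states : seq (Z * Z)) (x : Z * Z) : bool :=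
  if fuel is fuel'.+1 then
    if x \in states then true
    else if form K x mod m \in squares then false
    else orbit_avoids m K squares fuel' (x :: states) (stepm m K x)
  else false.

(** The hypothesis on [states] is the loop invariant. When x repeats, it makes the visited set
    closed under [stepm], so the whole orbit stays inside it. *)
Lemma orbit_avoidsP (m K : Z) (squares : seq Z) (fuel : nat)
    (states : seq (Z * Z)) (x : Z * Z) :
  orbit_avoids m K squares fuel states x ->
  {in states, forall y, form K y mod m \notin squares /\
                       stepm m K y \in x :: states} ->
  forall i, form K (iter i (stepm m K) x) mod m \notin squares.
Proof.
move=> ok st; suff [V xV [_ VP]] : exists2 V : seq (Z * Z), x \in V &
    {subset states <= V} /\
    {in V, forall y, form K y mod m \notin squares /\ stepm m K y \in V}.
  have itV i : iter i (stepm m K) x \in V by elim: i => [//|i /VP[_]].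
  by move=> i; have [] := VP _ (itV i).
elim: fuel states x ok st => [//|fuel IH] states x /=.
case: ifPn => [xst _ st|_].
  exists states => //; split=> // y /[dup] yst /st[? ]; rewrite inE.
  by case/predU1P => [->|].
case: ifPn => [//|xs ok st]; have [|V nV [subV VP]] := IH _ _ ok.
  move=> y; rewrite inE => /predU1P[->|/st[? ys]]; first by rewrite mem_head.
  by rewrite inE ys orbT.
exists V; first by apply: subV; exact: mem_head.
by split=> // y yst; apply: subV; rewrite inE yst orbT.
Qed.

Definition squares_mod (m : Z) : seq Z :=
  [seq Z.of_nat i * Z.of_nat i mod m | i <- iota 0 (Z.to_nat m)].

Lemma mem_squares_mod (m r : Z) : 0 < m -> r * r mod m \in squares_mod m.
Proof.
move=> m0; apply/mapP; exists (Z.to_nat (r mod m)).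
  by rewrite mem_iota /=; have := Z.mod_pos_bound r m; lia.
by rewrite Z2Nat.id -?Zmult_mod //; have := Z.mod_pos_bound r m; lia.
Qed.

Lemma form_nonsquare_mod (m K : Z) (j : nat) (r : Z) : 0 < m ->
  form (K mod m) (iter j (stepm m (K mod m)) (2, 1)) mod m \notin squares_mod m ->
  form K (orbit_pt K j) <> r * r.
Proof.
move=> m0 /negP nsq formE; apply: nsq.
have fE := form_reduce m K (orbit_pt K j).
have yE := orbit_pt_mod m K j; set y := iter _ _ _ in yE *.
have := form_reduce m (K mod m) y; rewrite /eqm yE Zmod_mod fE formE => <-.
exact: mem_squares_mod.
Qed.

                                                                                   
                                                                      
(** The first three points must be skipped: for k = 20 mod 79, F(2, 1) = 4 k^2 + 1 is 10^2 modulo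
    79. *)
Definition nonsquare_class (m c : Z) : bool :=
  orbit_avoids m c (squares_mod m) 300 [::] (iter 3 (stepm m c) (2, 1)).

Lemma nonsquare_classP (m K : Z) (j : nat) (r : Z) :
  0 < m -> nonsquare_class m (K mod m) -> (3 <= j)%N ->
  form K (orbit_pt K j) <> r * r.
Proof.
move=> m0 /orbit_avoidsP ok j3; apply: (form_nonsquare_mod m) => //.
by rewrite -(subnK j3) iterD; apply: ok.
Qed.

(** * The first three points of the orbit *)

Lemma not_square_between (a x r : Z) :
  0 <= a -> a * a < x < (a + 1) * (a + 1) -> x <> r * r.
Proof.
move=> a0 ax; rewrite -Z.abs_square => xE; have := Z.abs_nonneg r.
have [ra|ra] : Z.abs r <= a \/ a + 1 <= Z.abs r by lia.
  by nia.
by nia.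
Qed.

(** The bound B survives each Horner step: a + K y >= -1000 B + 1001 B = B. *)
Lemma horner_pos (B K b : Z) (l : seq Z) :
  0 < B -> 1001 <= K -> B <= b -> all (fun a => - (B * 1000) <=? a) l ->
  0 < foldr (fun a y => a + K * y) b l.
Proof.
move=> B0 K0 Bb al; suff : B <= foldr (fun a y => a + K * y) b l by lia.
elim: l al => [//|a l IH] /= /andP[/Z.leb_le aB /IH].
by move: (foldr _ _ _) => y By; have := Z.mul_nonneg_nonneg (K - 1001) y; lia.
Qed.

                                                                                
                                                                            
                                                                                   
                                            
(** Runge's method: F(x_2, y_2) is a polynomial of degree 21 in K, equal to K H^2 - R with H and R
    of degree 10. For large k it lies strictly between (k H - 1)^2 and (k H)^2. *)
Lemma form_orbit_pt2_runge (k r : Z) : 1300 <= k ->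
  form (k * k) (orbit_pt (k * k) 2) <> r * r.
Proof.
move=> k1300; set K := k * k; have K0 : 1001 <= K by rewrite /K; nia.
pose H := foldr (fun a y => a + K * y) 65536 [:: -1884; 2056; 16113; 43296;
  84160; 128512; 169472; 188416; 180224; 131072].
pose R := foldr (fun a y => a + K * y) 161218560 [:: -1600; 3472480; -9144356;
  -70432896; -187927296; -310384640; -317888512; -156991488; 96272384;
  230162432].
have H0 : 0 < H by apply: (horner_pos 65536).
have R0 : 0 < R by apply: (horner_pos 1000000).
(* The lower bound requires 2 k H > R + 1. The leading coefficients of R and H have ratio 2460,
   below 2600 = 2 * 1300. *)
have HR : 0 < 2600 * H - R - 1.
  have -> : 2600 * H - R - 1 = foldr (fun a y => a + K * y) 9175040
      [:: -4896801; 1873120; 51038156; 183002496; 406743296; 644515840;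
          758515712; 646873088; 372310016; 110624768].
    by cbv [H R foldr]; ring.
  by apply: (horner_pos 1000000).
have formE : form K (orbit_pt K 2) = (k * H) * (k * H) - R.
  transitivity (K * (H * H) - R); last by rewrite /K; ring.
  by cbv [form orbit_pt step iter fst snd H R foldr]; ring.
by apply: (not_square_between (k * H - 1)); nia.
Qed.

                                                                                
                                             
Definition sieve {A B : Type} (P : A -> B -> bool) (s : seq A) (l : seq B) : seq B :=
  foldl (fun l a => [seq b <- l | ~~ P a b]) l s.

Lemma sieve_nil {A : Type} {B : eqType} (P : A -> B -> bool) (s : seq A) (l : seq B) :
  nilp (sieve P s l) -> {in l, forall b, has (P^~ b) s}.
Proof.
elim: s l => [|a s IH] l /= sl b bl; first by move: bl; rewrite (nilP sl).
by case Pab: (P a b) => //=; apply: (IH _ sl); rewrite mem_filter Pab.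
Qed.

Lemma mem_traject_succ (a z : Z) (n : nat) :
  a <= z < a + Z.of_nat n -> z \in traject Z.succ a n.
Proof.
move=> az; apply/trajectP; exists (Z.to_nat (z - a)); first by lia.
have iterE i : iter i Z.succ a = a + Z.of_nat i.
  by elim: i => [|i IH]; [rewrite Z.add_0_r | rewrite iterS IH; lia].
by rewrite iterE; lia.
Qed.

Lemma form_orbit_pt2_small (k r : Z) : 0 < k < 1300 ->
  form (k * k) (orbit_pt (k * k) 2) <> r * r.
Proof.
move=> kb; set K := k * k; pose ms := [:: 3; 47; 23; 37; 11; 7].
have : nilp (sieve (fun m k => let c := k * k mod m in
    form c (iter 2 (stepm m c) (2, 1)) mod m \notin squares_mod m)
    ms (traject Z.succ 1 1299)) by vm_compute.
move=> /sieve_nil /(_ k); rewrite mem_traject_succ; last by lia.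
move=> /(_ isT) /hasP[m m_in]; apply: form_nonsquare_mod.
exact/Z.ltb_lt/(allP (isT : all (Z.ltb 0) ms)).
Qed.

Lemma form_orbit_pt_lt3 (k r : Z) (j : nat) : 0 < k -> (j < 3)%N ->
  form (k * k) (orbit_pt (k * k) j) <> r * r.
Proof.
move=> k0; case: j => [|[|[|//]]] _.
- by apply: (not_square_between (2 * k)); cbv [form orbit_pt iter fst snd]; lia.
- have [->|k2] : k = 1 \/ 2 <= k by lia.
    by apply: (not_square_between 30).
  (* With s = 4 K + 1 the value is (k (s^2 + 4))^2 + (2 s)^2, and (2 s)^2 is smaller than the gap to
     the next square once k >= 2. *)
  apply: (not_square_between (k * (16 * (k * k) * (k * k) + 8 * (k * k) + 5))).
    by nia.
  have -> : form (k * k) (orbit_pt (k * k) 1) =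
      (k * (16 * (k * k) * (k * k) + 8 * (k * k) + 5)) *
      (k * (16 * (k * k) * (k * k) + 8 * (k * k) + 5)) +
      4 * (4 * (k * k) + 1) * (4 * (k * k) + 1).
    by cbv [form orbit_pt step iter fst snd]; ring.
  set K := k * k; have K4 : 4 <= K by rewrite /K; nia.
  suff : 4 * (4 * K + 1) * (4 * K + 1) < 4 * (16 * K * K + 8 * K + 5) by nia.
  by lia.
- have [k_small|k_large] : k < 1300 \/ 1300 <= k by lia.
    exact: form_orbit_pt2_small.
  exact: form_orbit_pt2_runge.
Qed.

(** * Certified residue classes *)

Definition Z_table (T : seq (int * seq int)) : seq (Z * seq Z) :=
  [seq (Z_of_int c.1, [seq Z_of_int r | r <- c.2]) | c <- T].

Definition in_class (c : Z * seq Z) (k : Z) : bool := k mod c.1 \in c.2.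

Definition nonsquare_table (T : seq (Z * seq Z)) : bool :=
  all (fun c => (0 <? c.1) &&
    all (fun r => nonsquare_class c.1 (r * r mod c.1)) c.2) T.

Lemma nonsquare_table_cat (T1 T2 : seq (Z * seq Z)) :
  nonsquare_table (T1 ++ T2) = nonsquare_table T1 && nonsquare_table T2.
Proof. exact: all_cat. Qed.

Lemma nonsquare_tableP (T : seq (Z * seq Z)) (k : Z) (j : nat) (r : Z) :
  nonsquare_table T -> has (in_class^~ k) T -> (3 <= j)%N ->
  form (k * k) (orbit_pt (k * k) j) <> r * r.
Proof.
move=> /allP TP /hasP[[m rs] /TP /andP[/Z.ltb_lt m0 /allP rsP] /rsP].
by rewrite -Zmult_mod; exact: nonsquare_classP.
Qed.

                                                                                     
(** Modulo 2 everything is a square, but k^2 = 1 mod 8 and then F is 5 mod 8 along the whole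
    orbit. *)
Lemma form_odd_nonsquare (k : Z) (j : nat) (r : Z) : k mod 2 = 1 -> (3 <= j)%N ->
  form (k * k) (orbit_pt (k * k) j) <> r * r.
Proof.
move=> k1; apply: (nonsquare_classP 8) => //.
suff -> : k * k mod 8 = 1 by vm_compute.
have [n [b [-> b01]]] : exists n b, k = 4 * n + 2 * b + 1 /\ (b = 0 \/ b = 1).
  exists (k / 2 / 2), (k / 2 mod 2).
  have := Z.div_mod k 2; have := Z.div_mod (k / 2) 2.
  by have := Z.mod_pos_bound (k / 2) 2; lia.
pose t := 2 * n * n + n + b * (2 * n + 1).
rewrite -[RHS](Z.mod_add 1 t 8) //; congr (_ mod _).
by rewrite /t; case: b01 => ->; lia.
Qed.

                                                                                   
                                              
(** Further classes passing the same test, which cover the multiples of 6 up to 10^6 that the listed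
    classes miss. *)
Definition extra_table : seq (Z * seq Z) :=
  [:: (79, [:: 2; 11; 16; 22; 41; 63]);
   (83, [:: 31; 38]);
   (89, [:: 37; 38; 77; 82; 85]);
   (97, [:: 72; 80]);
   (107, [:: 10; 32; 40; 75]);
   (113, [:: 9; 35; 61; 78; 85; 104]);
   (127, [:: 23]);
   (137, [:: 119; 131]);
   (139, [:: 39]);
   (149, [:: 37; 47; 112]);
   (167, [:: 128; 154; 156]);
   (191, [:: 86; 104]);
   (227, [:: 36]);
   (229, [:: 79]);
   (233, [:: 139]);
   (271, [:: 206]);
   (307, [:: 116]);
   (337, [:: 275]);
   (367, [:: 61; 139])].

Definition odd_table : seq (Z * seq Z) := Z_table (behead residue_table).

Lemma nonsquare_odd_table : nonsquare_table odd_table.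
Proof. by vm_compute. Qed.

Lemma nonsquare_extra_table : nonsquare_table extra_table.
Proof. by vm_compute. Qed.

Lemma tables_cover (k : Z) : 0 < k <= 1000000 -> k mod 6 = 0 ->
  has (in_class^~ k) (odd_table ++ extra_table).
Proof.
move=> kb k6.
(* The quotients k / 6 run from 1 to 166666 = 334 * 499, sieved in 334 blocks of 499. *)
have : all (fun a => nilp (sieve in_class (odd_table ++ extra_table)
    [seq 6 * (499 * a + b) | b <- traject Z.succ 1 499])) (traject Z.succ 0 334).
  by vm_compute.
pose a := (k / 6 - 1) / 499.
have k6E : k = 6 * (k / 6) by have := Z.div_mod k 6; lia.
have aE : k / 6 - 1 = 499 * a + (k / 6 - 1) mod 499 by exact: Z.div_mod.
have := Z.mod_pos_bound (k / 6 - 1) 499; move=> /(_ ltac:(lia)) rb.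
move=> /allP /(_ a); rewrite mem_traject_succ; last by lia.
move=> /(_ isT) /sieve_nil; apply; apply/mapP.
by exists ((k / 6 - 1) mod 499 + 1); [apply: mem_traject_succ; lia | lia].
Qed.

Lemma square_mod3 (s : Z) : s * s mod 3 = 0 \/ s * s mod 3 = 1.
Proof.
rewrite Zmult_mod; have := Z.mod_pos_bound s 3; move=> /(_ ltac:(lia)) sb.
have [->|[->|->]] : s mod 3 = 0 \/ s mod 3 = 1 \/ s mod 3 = 2 by lia.
- by left.
- by right.
- by right.
Qed.

(** * Return to the polynomials *)

Lemma delta_epsilon_not_square (k : Z) (D E : nat -> Z) :
    k <> 0 -> D 0%N = 2 * (k * k) -> E 0%N = k ->
    (forall n, D n.+1 = D n * D n + E n * E n) ->
    (forall n, E n.+1 * k = D n * E n) ->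
    (forall j r, (3 <= j)%N -> form (k * k) (orbit_pt (k * k) j) <> r * r) ->
  forall n r, D n <> r * r.
Proof.
move=> k0 D0 E0 DS ES k_class n r; rewrite -(odd_double_half n).
have [y y0 [Dj _ DSj]] := delta_epsilon_orbit k D E k0 D0 E0 DS ES n./2.
case: (odd n); rewrite ?add1n ?add0n.
  rewrite DSj => /square_div_square [|s]; first by nia.
  have [j3|j3] := ltnP n./2 3; last exact: k_class.
  (* Only k^2 enters, so k may be replaced by its absolute value. *)
  by rewrite -(Z.abs_square k); apply: form_orbit_pt_lt3 => //; lia.
rewrite Dj => /square_div_square [|s uE]; first by nia.
have := orbit_mod3 (k * k) n./2 (square_mod3 k).
by rewrite uE; case: (square_mod3 s) => ->.
Qed.

Lemma delta_not_square (k : int) (n : nat) : k != 0%R ->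
    (forall j r, (3 <= j)%N -> let K := Z_of_int k * Z_of_int k in
      form K (orbit_pt K j) <> r * r) ->
  (1 <= n)%N -> ~ is_perfect_square (delta n).[k]%R.
Proof.
case: n => [//|n] k0 k_class _ [m dE].
apply: (delta_epsilon_not_square (Z_of_int k)
  (fun n => Z_of_int (delta n.+1).[k]%R) (fun n => Z_of_int (epsilon n.+1).[k]%R)
  _ _ _ _ _ k_class n (Z_of_int m)).
- by move: k0; lia.
- by rewrite delta1 !hornerE /= !rmorphM; exact: esym (Z.mul_assoc 2 _ _).
- by rewrite epsilon1 hornerX.
- by move=> i; rewrite deltaS !hornerE rmorphD !rmorphXn.
- move=> i; transitivity (Z_of_int (epsilon i.+2 * 'X).[k]%R).
    by rewrite hornerM hornerX rmorphM.
  by rewrite epsilon_mulX hornerM rmorphM.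
- by rewrite dE rmorphXn.
Qed.

Lemma satisfies_congruence_class (k : int) : satisfies_congruence k ->
  Z_of_int k mod 2 = 1 \/ has (in_class^~ (Z_of_int k)) odd_table.
Proof.
case=> c c_in [r r_in kr].
have {kr} [q kE] : exists q, k = (r + q * c.1)%R.
  have /eqP := kr; rewrite eqz_mod_dvd => /dvdzP[q /eqP].
  by rewrite subr_eq addrC => /eqP ->; exists q.
have {kE} kmod : Z_of_int k mod Z_of_int c.1 = Z_of_int r mod Z_of_int c.1.
  by rewrite kE rmorphD rmorphM; exact: Z_mod_plus_full.
move: c_in; rewrite inE => /predU1P[cE|c_in].
  by left; move: r_in kmod; rewrite cE inE => /eqP ->.
right; apply/hasP; exists (Z_of_int c.1, [seq Z_of_int r | r <- c.2]).
  by apply/mapP; exists c.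
(* The listed residues are canonical, so a congruence becomes membership of k mod p in the list. *)
have reduced : all (fun c => all (fun r => r mod c.1 == r) c.2) odd_table.
  by vm_compute.
rewrite /in_class kmod; have /allP := reduced.
move=> /(_ (Z_of_int c.1, [seq Z_of_int r | r <- c.2])) /= /(_ (map_f _ c_in)).
by move=> /allP /(_ _ (map_f _ r_in)) /eqP ->; exact: map_f.
Qed.

Lemma form_not_square_le_million (k r : Z) (j : nat) :
  0 < k <= 1000000 -> (3 <= j)%N -> form (k * k) (orbit_pt (k * k) j) <> r * r.
Proof.
move=> kb j3; have := Z.mod_pos_bound k 2; move=> /(_ ltac:(lia)) k2b.
have [k_even|k_odd] : k mod 2 = 0 \/ k mod 2 = 1 by lia.
  have tables_ok : nonsquare_table (odd_table ++ extra_table).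
    by rewrite nonsquare_table_cat nonsquare_odd_table nonsquare_extra_table.
  apply: nonsquare_tableP tables_ok _ j3.
  have := Z.mod_pos_bound k 3; move=> /(_ ltac:(lia)) k3b.
  have [k3|k3] : k mod 3 = 0 \/ (k mod 3 = 1 \/ k mod 3 = 2) by lia.
    apply: tables_cover => //.
    have := Z.div_mod k 2; have := Z.div_mod k 3; have := Z.div_mod k 6.
    by have := Z.mod_pos_bound k 6; lia.
  apply/hasP; exists (3, [:: 1; 2]); last by rewrite /in_class; case: k3 => ->.
  by rewrite mem_cat; apply/orP; left; vm_compute.
exact: form_odd_nonsquare.
Qed.

Lemma Z_of_int_norm_bound (k : int) : (1 <= `|k| <= 10 ^+ 6)%R ->
  0 < Z.abs (Z_of_int k) <= 1000000.
Proof.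
have -> : 1000000 = Z_of_int (10 ^+ 6)%R by rewrite rmorphXn.
by move: (10 ^+ 6)%R => b; lia.
Qed.

Local Close Scope Z_scope.
Local Open Scope ring_scope.

Theorem theorem19 :
  (forall k0 : int, k0 != 0 -> satisfies_congruence k0 ->
     forall n : nat, (1 <= n)%N -> ~ is_perfect_square (delta n).[k0]) /\
  (forall n : nat, (1 <= n)%N ->
     forall k0 : int, 1 <= `|k0| <= 10 ^+ 6 ->
       ~ is_perfect_square (delta n).[k0]).
Proof.
split=> [k k0 kc n|n n1 k kb].
  apply: delta_not_square => // j r j3.
  have [k_odd|k_table] := satisfies_congruence_class k kc.
    exact: form_odd_nonsquare.
  exact: nonsquare_tableP nonsquare_odd_table k_table j3.
apply: delta_not_square n1; first by move: kb; case: eqP => // ->.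
move=> j r j3; rewrite -Z.abs_square.
exact: form_not_square_le_million (Z_of_int_norm_bound k kb) j3.
Qed.
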